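(* Let $G$ be a finite group acting $2$-transitively on $\Omega$, and let $\psi\in\mathrm{Irr}(G)$ be such that $1+\psi$ is the permutation character of this action. Let $L$ be a $(G,\Omega)$-Cameron-Liebler set with parameter $x$, and let $X\subseteq L$ and $Y\subseteq G\setminus L$ with $|X|=|Y|$. Then $\bar L=(L\setminus X)\cup Y$ is a Cameron-Liebler set of parameter $x$ if and only if $$\psi(Xg^{-1})-\psi(Yg^{-1})=(\delta_X(g)-\delta_Y(g))\frac{|G|}{\psi(1)}\quad\text{for all } g\in G.$$
   Context: For $S\subseteq G$, $\psi(S)=\sum_{s\in S}\psi(s)$ and $Sg^{-1}=\{sg^{-1}:s\in S\}$; $\delta_S(g)=1$ if $g\in S$ and $0$ otherwise. The permutation character is $g\mapsto$ number of fixed points of $g$. For $a,b\in\Omega$ the star is $G_{a\to b}=\{g:g(a)=b\}$ with indicator vector $\mathbf{v}_{a,b}$. A $(G,\Omega)$-Cameron-Liebler set is a subset of $G$ whose indicator vector is a linear combination of the $\mathbf{v}_{a,b}$; its parameter is $|L|\,|\Omega|/|G|$. *)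

(* Defs.v *)
From HB Require Import structures.
From mathcomp Require Import all_boot all_order all_algebra.
From mathcomp Require Import all_fingroup all_solvable all_field all_character.

Set Implicit Arguments.
Unset Strict Implicit.
Unset Printing Implicit Defensive.

Import GroupScope Order.TTheory GRing.Theory Num.Theory.
Local Open Scope ring_scope.

(* MathComp actions are right actions, so [to a g] stands for g(a). A left
   action g(a) is the right action [to a g := g^-1(a)]: this exchanges the
   stars G_{a -> b} and G_{b -> a} and preserves the permutation character
   (and 2-transitivity), so nothing below depends on the side. *)

Section CameronLiebler.

Variables (gT : finGroupType) (Omega : finType) (to : {action gT &-> Omega}).
Variable G : {group gT}.

Fact cfPerm_subproof :
  is_class_fun <<G>> [ffun g => #|'Fix_to[g]%g|%:R *+ (g \in G)].
Proof.
rewrite genGid; apply: intro_class_fun => [x y Gx Gy | _ /negbTE-> //].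
rewrite groupJr //; congr (_%:R *+ _).
rewrite -(card_setact to 'Fix_to[x]%g y); apply: eq_card => a.
apply/afix1P/imsetP => [fix_a | [b /afix1P fix_b ->]]; last first.
  by rewrite -actM -conjgC actM fix_b.
exists (to a y^-1%g); last by rewrite actKV.
apply/afix1P; apply: (@act_inj _ _ _ to y).
by rewrite actKV -2!actM -conjgE fix_a.
Qed.
Definition cfPerm : 'CF(G) := Cfun 0 cfPerm_subproof.

Definition star (a b : Omega) : {set gT} := [set g in G | to a g == b].

(* Vectors are indexed by all of gT; those of interest vanish outside G. *)
Definition indicator_vec (S : {set gT}) : {ffun gT -> algC^o} :=
  [ffun g => (g \in S)%:R].

Definition cameron_liebler (L : {set gT}) : Prop :=
  L \subset G /\
  exists c : Omega -> Omega -> algC,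
    indicator_vec L = \sum_(a : Omega) \sum_(b : Omega)
                        c a b *: indicator_vec (star a b).

Definition cl_parameter (L : {set gT}) : rat :=
  #|L|%:R * #|Omega|%:R / #|G|%:R.

Definition cameron_liebler_of_parameter (x : rat) (L : {set gT}) : Prop :=
  cameron_liebler L /\ cl_parameter L = x.

End CameronLiebler.

Definition char_sum (gT : finGroupType) (G : {group gT}) (psi : 'CF(G))
  (S : {set gT}) : algC := \sum_(s in S) psi s.

Definition delta (gT : finGroupType) (S : {set gT}) (g : gT) : algC :=
  (g \in S)%:R.

(* Main.v *)
Require Import Defs.
From HB Require Import structures.
From mathcomp Require Import all_boot all_order all_algebra.
From mathcomp Require Import all_fingroup all_solvable all_field all_character.
From mathcomp Require Import ring.

Set Implicit Arguments.
Unset Strict Implicit.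
Unset Printing Implicit Defensive.

Import GroupScope Order.TTheory GRing.Theory Num.Theory.
Local Open Scope ring_scope.

(* Put f = 1_X - 1_Y, whose entries sum to 0. As |L-bar| = |L|, the question is
   whether f lies in the span of the stars. Since psi = fix - 1, and g and h
   agree at as many points as h g^-1 fixes, convolution by psi sends f to
   g |-> sum_(a, b) <f, v_(a,b)> v_(a,b)(g), which is in the span of the stars.
   Conversely, counting with 2-transitivity, convolution by psi multiplies
   v_(a,b) - 1_G / |Omega| by |G| / psi(1), and the vectors of sum 0 in the span
   of the stars are the combinations of these. *)

Section Stars.

Variables (gT : finGroupType) (Omega : finType) (to : {action gT &-> Omega}).
Variable G : {group gT}.

Local Notation star := (star to G).
Local Notation n := #|Omega|.

Lemma star_sub a b : star a b \subset G.
Proof. by apply/subsetP=> h; rewrite inE => /andP[]. Qed.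

Lemma partition_star a (A : {set gT}) :
  A \subset G -> #|A| = (\sum_b #|A :&: star a b|)%N.
Proof.
move=> sAG; rewrite -sum1_card (partition_big (to a) predT) //=.
apply: eq_bigr => b _; rewrite -sum1_card; apply: eq_bigl => h.
by rewrite !inE; case Ah: (h \in A) => //=; rewrite (subsetP sAG).
Qed.

(** Right multiplication by an element of [G] taking [c] to [d] maps [star a c] into [star a d]. So
    the [n] stars out of [a], which partition [G], have equal size. *)
Lemma card_star a b : [transitive G, on [set: Omega] | to] ->
  (n * #|star a b|)%N = #|G|.
Proof.
move=> trG.
have le_star c d : (#|star a c| <= #|star a d|)%N.
  have [k Gk def_d] := atransP2 trG (in_setT c) (in_setT d).
  rewrite -(card_rcoset _ k); apply/subset_leq_card/subsetP=> _ /rcosetP[h + ->].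
  by rewrite !inE => /andP[Gh /eqP ac]; rewrite groupM //= actM ac -def_d.
rewrite (partition_star a (subxx G)) -sum_nat_const.
apply: eq_bigr => c _; rewrite (setIidPr _); last exact: star_sub.
by apply/eqP; rewrite eqn_leq !le_star.
Qed.

Hypothesis G_2trans : [transitive^2 G, on [set: Omega] | to].

Let G_trans : [transitive G, on [set: Omega] | to].
Proof. exact: ntransitive1 G_2trans. Qed.

(** The sets [star c e] cut [star a b] into pieces. The piece for [e = b] is empty by injectivity,
    and 2-transitivity makes the other [n - 1] equal in size. *)
Lemma card_star2 a b c d : c != a -> d != b ->
  (n.-1 * #|star a b :&: star c d|)%N = #|star a b|.
Proof.
move=> neq_ca neq_db.
have le_star e f : e != b -> f != b ->
  (#|star a b :&: star c e| <= #|star a b :&: star c f|)%N.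
- move=> neq_eb neq_fb.
  have dt2 z : z != b -> [tuple b; z] \in 2.-dtuple([set: Omega])%g.
    by move=> neq_zb; rewrite inE memtE subset_all /= !inE eq_sym neq_zb.
  (* As [k] fixes [b], right translation by [k] stays inside [star a b] while it moves [star c e]
     into [star c f]. *)
  have [k Gk [def_b def_f]] := atransP2 G_2trans (dt2 e neq_eb) (dt2 f neq_fb).
  rewrite -(card_rcoset _ k); apply/subset_leq_card/subsetP=> _ /rcosetP[h + ->].
  rewrite !inE => /andP[/andP[Gh /eqP ab] /andP[_ /eqP ce]].
  by rewrite groupM //= !actM ab ce -def_b -def_f !eqxx.
rewrite [RHS](partition_star c (star_sub a b)) (bigD1 b) //= [X in (X + _)%N](_ : _ = 0%N).
  rewrite add0n -(cardC1 b) -sum_nat_const; apply: eq_bigr => e neq_eb.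
  by apply/eqP; rewrite eqn_leq !le_star.
apply: eq_card0 => h; rewrite !inE; apply/negP=> /and3P[/andP[_ /eqP ab] _].
by rewrite -ab (inj_eq (act_inj _ _)) (negPf neq_ca).
Qed.

Variable psi : 'CF(G).
Hypothesis psi_perm : 1 + psi = cfPerm to G.

Lemma psiE g : g \in G -> psi g = (\sum_a (to a g == a)%:R) - 1.
Proof.
move=> Gg; have /cfunP/(_ g) := psi_perm.
rewrite cfunE cfun1E Gg cfunE Gg mulr1n => fixE.
rewrite -natr_sum -(addKr 1 (psi g)) fixE addrC; congr (_%:R - _).
rewrite -sum1_card big_mkcond; apply: eq_bigr => a _.
by rewrite (sameP afix1P eqP); case: eqP.
Qed.

Lemma psi1E : psi 1%g = n%:R - 1.
Proof.
rewrite psiE //; congr (_ - 1).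
by rewrite (eq_bigr (fun=> 1)) ?sumr_const // => a _; rewrite act1 eqxx.
Qed.

Lemma psi_div g h : g \in G -> h \in G ->
  psi (h * g^-1)%g = (\sum_a (to a h == to a g)%:R) - 1.
Proof.
move=> Gg Gh; rewrite psiE ?groupM ?groupV //; congr (_ - 1).
by apply: eq_bigr => a _; rewrite actM (canF_eq (actKV _ _)).
Qed.

Hypothesis psi1_neq0 : psi 1%g != 0.

Let n_neq0 : n%:R != 0 :> algC.
Proof.
have /imsetP[a _ _] := G_trans.
by rewrite pnatr_eq0 -lt0n; apply/card_gt0P; exists a.
Qed.

Lemma natr_card_star a b : #|star a b|%:R = #|G|%:R / n%:R :> algC.
Proof.
apply: (mulfI n_neq0); rewrite -natrM (card_star _ _ G_trans).
by rewrite mulrCA divff ?mulr1.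
Qed.

(** Count the agreements of [g] with the elements [h] of [star a b] point by point. With [N] the
    size of this star, the point [a] contributes [N] or 0 according as [to a g] is [b] or not; any
    other [c] contributes [N / (n - 1)], or 0 when [to c g] is [b]. The constant -1 in [psi]
    subtracts a further [N]. *)
Lemma sum_star_psi a b g : g \in G ->
  \sum_(h in star a b) psi (h * g^-1)%g =
  #|G|%:R / psi 1%g * ((g \in star a b)%:R - n%:R^-1).
Proof.
move=> Gg; set N : algC := #|star a b|%:R.
have in_star : (g \in star a b) = (to a g == b) by rewrite inE Gg.
have agree c : \sum_(h in star a b) (to c h == to c g)%:R =
               #|star a b :&: star c (to c g)|%:R :> algC.
  rewrite -sum1_card natr_sum big_mkcond [RHS]big_mkcond.
  apply: eq_bigr => h _; rewrite !inE.
  by case: (h \in G) => //=; case: ifP => //= _; case: ifP.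
(* The factor [psi 1%g], equal to [n - 1], clears the denominator of [N / (n - 1)]. *)
have other c : c != a ->
  psi 1%g * #|star a b :&: star c (to c g)|%:R = (to c g != b)%:R * N.
- move=> neq_ca; have [-> | neq_cgb] := eqVneq (to c g) b.
    rewrite mul0r (_ : _ :&: _ = set0) ?cards0 ?mulr0 //.
    apply/setP=> h; rewrite !inE; apply/negP=> /andP[/andP[_ /eqP ab] /andP[_]].
    by rewrite -ab (inj_eq (act_inj _ _)) (negPf neq_ca).
  rewrite mul1r /N -(card_star2 neq_ca neq_cgb) natrM psi1E; congr (_ * _).
  by apply/eqP; rewrite subr_eq natr1 prednK // lt0n -(pnatr_eq0 algC).
(* Since [g] permutes the points, [n - 1] of them are not sent to [b]; the point [a] is then
   discounted if it is one of these. *)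
have sum_other : \sum_(c | c != a) (to c g != b)%:R =
                 psi 1%g - (to a g != b)%:R :> algC.
  have sum_all : \sum_c (to c g != b)%:R = psi 1%g :> algC.
    rewrite (reindex_inj (act_inj to g^-1%g)) /=.
    under eq_bigr do rewrite actKV.
    rewrite -natr_sum -big_mkcond /= sum1_card cardC1 psi1E.
    by rewrite -subn1 natrB // lt0n -(pnatr_eq0 algC).
  by rewrite -sum_all [in RHS](bigD1 a) //= [RHS]addrC addKr.
transitivity (\sum_c #|star a b :&: star c (to c g)|%:R - N : algC).
  rewrite -(eq_bigr _ (fun c _ => agree c)) exchange_big /N -sum1_card natr_sum.
  rewrite -sumrB; apply: eq_bigr => h abh; rewrite psi_div //.
  exact: (subsetP (star_sub a b)).
have same : #|star a b :&: star a (to a g)|%:R = (to a g == b)%:R * N.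
  have [-> | neq_agb] := eqVneq (to a g) b; first by rewrite setIid mul1r.
  rewrite mul0r (_ : _ :&: _ = set0) ?cards0 //.
  apply/setP=> h; rewrite !inE; apply/negP=> /andP[/andP[_ /eqP ->] /andP[_]].
  by rewrite eq_sym (negPf neq_agb).
apply: (mulfI psi1_neq0).
rewrite (bigD1 a) //= mulrBr mulrDr mulr_sumr (eq_bigr _ other) -mulr_suml.
(* Eliminating [n] leaves a rational identity in [psi 1%g] alone, up to the factor [#|G|]. *)
have def_n : n%:R = psi 1%g + 1 by rewrite psi1E subrK.
rewrite sum_other same in_star /N natr_card_star; move: n_neq0; rewrite def_n.
by case: (to a g == b) => psi1_neqN1 /=; field; rewrite psi1_neq0 psi1_neqN1.
Qed.

(** The span condition of [cameron_liebler], freed from indicator vectors: it must apply to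
    differences of these, which can take the value -1. *)
Definition in_star_span (f : {ffun gT -> algC^o}) :=
  exists c : Omega -> Omega -> algC,
    f = \sum_a \sum_b c a b *: indicator_vec (star a b).

(** Serves twice: with [F] constant it gives the entry sum of a combination of stars, and with [F] a
    translate of [psi] its convolution. *)
Lemma sum_star_comb c (F : gT -> algC) :
  \sum_h (\sum_a \sum_b c a b *: indicator_vec (star a b)) h * F h =
  \sum_a \sum_b c a b * \sum_(h in star a b) F h.
Proof.
under eq_bigr do rewrite sum_ffunE mulr_suml.
rewrite exchange_big; apply: eq_bigr => a _.
under eq_bigr do rewrite sum_ffunE mulr_suml.
rewrite exchange_big; apply: eq_bigr => b _.
rewrite mulr_sumr [RHS]big_mkcond; apply: eq_bigr => h _.
by rewrite !ffunE; case: ifP; rewrite /= ?scaler0 ?mul0r // /GRing.scale /= mulr1.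
Qed.

(** The zero sum of [f] acts in both directions: it makes the coefficients of the stars sum to 0,
    and it cancels the constant -1 in [psi]. *)
Lemma in_star_spanP (f : {ffun gT -> algC^o}) :
  (forall h, h \notin G -> f h = 0) -> \sum_h f h = 0 ->
  in_star_span f <->
  (forall g, g \in G ->
     \sum_h f h * psi (h * g^-1)%g = f g * (#|G|%:R / psi 1%g)).
Proof.
move=> f_out sum_f; split=> [[c def_f] g Gg | f_eigen].
  have sum_c : (\sum_a \sum_b c a b) * (#|G|%:R / n%:R) = 0.
    transitivity (\sum_h f h * 1); last by under eq_bigr do rewrite mulr1.
    rewrite def_f sum_star_comb mulr_suml; apply: eq_bigr => a _; rewrite mulr_suml.
    by apply: eq_bigr => b _; rewrite -(natr_card_star a b) -sum1_card natr_sum.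
  have -> : f g = \sum_a \sum_b c a b * (g \in star a b)%:R.
    rewrite def_f sum_ffunE; apply: eq_bigr => a _; rewrite sum_ffunE.
    by apply: eq_bigr => b _; rewrite !ffunE.
  rewrite {1}def_f sum_star_comb.
  set K := #|G|%:R / psi 1%g.
  (* Each star leaves a term [- K / n] under convolution. Weighted by [c] these add up to 0, and
     subtracting that 0 on the right lets the identity be checked star by star. *)
  have sum_cK : (\sum_a \sum_b c a b) * (K / n%:R) = 0.
    by rewrite mulrAC mulrA sum_c mul0r.
  rewrite -[RHS]subr0 -[X in _ - X]sum_cK.
  rewrite !mulr_suml -sumrB; apply: eq_bigr => a _.
  rewrite !mulr_suml -sumrB; apply: eq_bigr => b _.
  by rewrite sum_star_psi // -/K; ring.
(* The inner products of [f] with the stars, divided by the eigenvalue [#|G|%:R / psi 1%g]. *)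
exists (fun a b => psi 1%g / #|G|%:R * \sum_(h in star a b) f h).
apply/ffunP=> g; rewrite sum_ffunE; under eq_bigr do rewrite sum_ffunE.
have [Gg | nGg] := boolP (g \in G); last first.
  rewrite f_out // big1 // => a _; rewrite big1 // => b _.
  by rewrite !ffunE inE (negPf nGg) scaler0.
transitivity (psi 1%g / #|G|%:R * \sum_h f h * psi (h * g^-1)%g).
  rewrite f_eigen //; field.
  by rewrite psi1_neq0 neq0CG.
transitivity (psi 1%g / #|G|%:R *
  (\sum_h f h * (\sum_a (to a h == to a g)%:R) - \sum_h f h)).
  congr (_ * _); rewrite -sumrB; apply: eq_bigr => h _.
  have [Gh | nGh] := boolP (h \in G); last by rewrite f_out // !mul0r subrr.
  by rewrite psi_div // mulrBr mulr1.
rewrite sum_f subr0; under [in LHS]eq_bigr do rewrite mulr_sumr.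
rewrite exchange_big mulr_sumr; apply: eq_bigr => a _.
(* Among the stars out of [a], only the one with [b = to a g] contains [g]. *)
rewrite [in RHS](bigD1 (to a g)) //= [X in _ + X]big1 => [|b neq_b]; last first.
  by rewrite !ffunE inE Gg eq_sym (negPf neq_b) scaler0.
rewrite !ffunE inE Gg eqxx addr0 [RHS]mulr1; congr (_ * _).
rewrite [RHS]big_mkcond; apply: eq_bigr => h _; rewrite inE.
have [Gh | nGh] := boolP (h \in G); last by rewrite f_out // mul0r.
by case: eqP => _; rewrite ?mulr1 ?mulr0.
Qed.

Lemma in_star_spanB f1 f2 :
  in_star_span f1 -> in_star_span f2 -> in_star_span (f1 - f2).
Proof.
move=> [c1 ->] [c2 ->]; exists (fun a b => c1 a b - c2 a b).
rewrite -sumrB; apply: eq_bigr => a _; rewrite -sumrB; apply: eq_bigr => b _.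
by rewrite scalerBl.
Qed.

End Stars.

(** Turns sums over translated sets into convolutions, which are linear in the vector, so that [X]
    and [Y] merge into the single vector [f]. *)
Lemma char_sum_rcoset (gT : finGroupType) (G : {group gT}) (psi : 'CF(G))
  (S : {set gT}) (g : gT) :
  char_sum psi (S :* g^-1)%g =
  \sum_h (indicator_vec S : {ffun gT -> algC^o}) h * psi (h * g^-1)%g.
Proof.
rewrite /char_sum -rcosetE /rcoset big_imset /=; last by move=> h k _ _; apply: mulIg.
rewrite big_mkcond; apply: eq_bigr => h _.
by rewrite ffunE; case: ifP; rewrite ?mul1r ?mul0r.
Qed.

Theorem theorem4p5 (gT : finGroupType) (Omega : finType)
  (to : {action gT &-> Omega}) (G : {group gT})
  (G_2trans : [transitive^2 G, on [set: Omega] | to])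
  (psi : 'CF(G)) (psi_irr : psi \in irr G)
  (psi_perm : 1 + psi = cfPerm to G)
  (x : rat) (L X Y : {set gT})
  (L_CL : cameron_liebler_of_parameter to G x L)
  (sXL : X \subset L) (sYGL : Y \subset G :\: L) (cardXY : #|X| = #|Y|) :
  cameron_liebler_of_parameter to G x ((L :\: X) :|: Y) <->
  (forall g : gT, g \in G ->
     char_sum psi (X :* g^-1)%g - char_sum psi (Y :* g^-1)%g =
     (delta X g - delta Y g) * (#|G|%:R / psi 1%g)).
Proof.
have psi1_neq0 : psi 1%g != 0 by have /irrP[i ->] := psi_irr; apply: irr1_neq0.
have [[sLG L_span] L_par] := L_CL.
have /subsetDP[sYG disYL] := sYGL.
set f : {ffun gT -> algC^o} := indicator_vec X - indicator_vec Y.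
have fE h : f h = indicator_vec X h - indicator_vec Y h by rewrite !ffunE.
have f_out h : h \notin G -> f h = 0.
  move=> nGh; rewrite !ffunE (negPf (contra (subsetP sYG h) nGh)).
  by rewrite (negPf (contra (subsetP (subset_trans sXL sLG) h) nGh)) subrr.
have sum_ind S : \sum_h (indicator_vec S : {ffun gT -> algC^o}) h = #|S|%:R.
  rewrite -sum1_card natr_sum [RHS]big_mkcond; apply: eq_bigr => h _.
  by rewrite ffunE; case: ifP.
have sum_f : \sum_h f h = 0.
  by rewrite (eq_bigr _ (fun h _ => fE h)) sumrB !sum_ind cardXY subrr.
have def_bar : indicator_vec (L :\: X :|: Y) = indicator_vec L - f.
  apply/ffunP=> h; rewrite !ffunE !inE.
  have [Xh | _] := boolP (h \in X).
    by rewrite (subsetP sXL) // (disjointFl disYL) ?(subsetP sXL) //= subr0 subrr.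
  have [Yh | _] := boolP (h \in Y); first by rewrite (disjointFr disYL) //= !sub0r opprK.
  by rewrite orbF subrr subr0.
have sub_bar : L :\: X :|: Y \subset G.
  by rewrite subUset sYG (subset_trans (subsetDl _ _)).
have par_bar : cl_parameter Omega G (L :\: X :|: Y) = x.
  rewrite -L_par /cl_parameter cardsU (_ : _ :&: Y = set0) ?cards0 ?subn0.
    by rewrite cardsD (setIidPr sXL) -cardXY subnK ?subset_leq_card.
  by apply/setP=> h; rewrite !inE; case Yh: (h \in Y); rewrite ?andbF // (disjointFr disYL) ?andbF.
(* The inclusion in [G] and the parameter are already settled, and the vector of [L] lies in the
   span, so the new vector does exactly when [f] does. *)
have bar_CL : cameron_liebler_of_parameter to G x (L :\: X :|: Y) <->
              in_star_span to G f.
  split=> [[[_ bar_span] _] | f_span].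
    rewrite (_ : f = indicator_vec L - indicator_vec (L :\: X :|: Y)).
      exact: in_star_spanB.
    by rewrite def_bar subKr.
  do 2?split=> //; rewrite def_bar; exact: in_star_spanB.
have convE g : char_sum psi (X :* g^-1)%g - char_sum psi (Y :* g^-1)%g =
               \sum_h f h * psi (h * g^-1)%g.
  rewrite !char_sum_rcoset -sumrB; apply: eq_bigr => h _.
  by rewrite -mulrBl fE.
have deltaE g : delta X g - delta Y g = f g by rewrite !ffunE.
have [f_eigen f_span] := in_star_spanP G_2trans psi_perm psi1_neq0 f_out sum_f.
split=> [/bar_CL/f_eigen f_eq g Gg | f_eq]; first by rewrite convE deltaE f_eq.
by apply/bar_CL/f_span => g Gg; rewrite -convE -deltaE f_eq.
Qed.
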